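(* Let $n\in\mathbb{N}$ and let $u\colon\mathbb{Z}^d\to\mathbb{R}$ be a single site potential with $\mathrm{supp}\,u\subset\Lambda_{-n}:=\{-n,\dots,0\}^d$ and $\bar u:=\sum_{k\in\mathbb{Z}^d}u(k)\neq0$. Consider the discrete alloy-type model $H_\omega=H_0+V_\omega$ with single site potential $u$ and coupling constants with density $f\in BV$. Then for any $L\in\mathbb{N}$, $E\in\mathbb{R}$ and $\epsilon>0$, \[ \mathbb{E}\left\{\mathrm{Tr}\big[\chi_{[E-\epsilon,E+\epsilon]}(H_{\omega,L})\big]\right\}\le\frac{4}{|\bar u|}\,\mathrm{rank}\,u\,\|f\|_{BV}\,\epsilon\,(L+n)^{d}. \] In particular, the function $\mathbb{R}\ni E\mapsto\mathbb{E}\left\{\mathrm{Tr}\big[\chi_{(-\infty,E]}(H_{\omega,L})\big]\right\}$ is Lipschitz continuous.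
   Context: Discrete alloy-type model: $H_0$ is an arbitrary symmetric operator on $\ell^2(\mathbb{Z}^d)$. The random part $V_\omega$ is the multiplication operator by $V_\omega(x)=\sum_{k\in\mathbb{Z}^d}\omega_k\,u(x-k)$, where $(\omega_k)_{k\in\mathbb{Z}^d}$ is an i.i.d. sequence of real random variables (the coupling constants), each having a density $f$, and $u$ is the single site potential. $\mathbb{E}$ denotes expectation with respect to the product measure associated with the $\omega_k$, $k\in\mathbb{Z}^d$. $BV$ denotes the space of functions with bounded total variation and $\|\cdot\|_{BV}$ the corresponding norm. $\mathrm{rank}\,u$ is the number of points in the support of $u$. For $L\in\mathbb{N}$ let $\Lambda_L=[0,L]^d\cap\mathbb{Z}^d$ with characteristic function $\chi_{\Lambda_L}$, let $\iota_L\colon\ell^2(\Lambda_L)\to\ell^2(\mathbb{Z}^d)$ be the canonical inclusion and $\pi_L\colon\ell^2(\mathbb{Z}^d)\to\ell^2(\Lambda_L)$ the adjoint restriction. The finite cube restriction of $H_\omega$ is the selfadjoint finite rank operator $H_{\omega,L}=\pi_LH_0\iota_L+V_\omega\chi_{\Lambda_L}$ on $\ell^2(\Lambda_L)$. $\chi_I$ is the characteristic function of $I\subset\mathbb{R}$, so $\mathrm{Tr}[\chi_I(H_{\omega,L})]$ is the number of eigenvalues of $H_{\omega,L}$ in $I$, counted with multiplicity. *)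

(* Defs.v *)
From HB Require Import structures.
From mathcomp Require Import all_boot all_order all_algebra.
From mathcomp Require Import finmap complex.
From mathcomp Require Import all_classical all_reals all_analysis.

Set Implicit Arguments.
Unset Strict Implicit.
Unset Printing Implicit Defensive.

Import Order.TTheory GRing.Theory Num.Theory.
Import numFieldNormedType.Exports.

Local Open Scope classical_set_scope.
Local Open Scope ring_scope.
Local Open Scope complex_scope.

Notation lattice d := 'rV[int]_d.

Section Operators.
Context {R : realType}.

(** The unconditional sum of an absolutely summable real family. *)
Definition rsum {I : choiceType} (a : I -> R) : R :=
  fine (\esum_(k in [set: I]) ((EFin \o a)^\+ k)
        - \esum_(k in [set: I]) ((EFin \o a)^\- k))%E.

Definition csum {I : choiceType} (a : I -> R[i]) : R[i] :=
  rsum (fun k => complex.Re (a k)) +i* rsum (fun k => complex.Im (a k)).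

Definition ell2 {I : choiceType} : set (I -> R[i]) :=
  [set phi | (\esum_(k in [set: I])
     (complex.Re (phi k) ^+ 2 + complex.Im (phi k) ^+ 2)%:E < +oo)%E].

Definition ell2_inner {I : choiceType} (phi psi : I -> R[i]) : R[i] :=
  csum (fun k => (phi k)^* * psi k).

(** A possibly unbounded symmetric operator on [ell2], given by its domain
    and its action there. The domain contains the finitely supported functions
    (hence is dense), which is what gives a meaning to the restrictions of the
    operator to finite cubes. Values of [H] outside [dom] are junk. *)
Record symmetric_operator {I : choiceType} (dom : set (I -> R[i]))
    (H : (I -> R[i]) -> (I -> R[i])) : Prop := SymmetricOperator {
  dom_ell2 : dom `<=` ell2;
  dom_finite_support : forall phi : I -> R[i],
    finite_set [set k | phi k != 0] -> dom phi;
  dom_linear : forall (a : R[i]) phi psi, dom phi -> dom psi ->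
    dom (fun k => a * phi k + psi k);
  op_ell2 : forall phi, dom phi -> ell2 (H phi);
  op_linear : forall (a : R[i]) phi psi, dom phi -> dom psi ->
    H (fun k => a * phi k + psi k) = (fun k => a * H phi k + H psi k);
  op_symmetric : forall phi psi, dom phi -> dom psi ->
    ell2_inner phi (H psi) = ell2_inner (H phi) psi }.

(** [g(A)] in the functional calculus of a self-adjoint matrix [A], where
    [A = P^-1 *m diag_mx D *m P] with [P] unitary and [D] real. *)
Definition mxcalc (g : R -> R) N (A : 'M[R[i]]_N) : 'M[R[i]]_N :=
  invmx (spectralmx A)
  *m diag_mx (map_mx (fun z => (g (complex.Re z))%:C) (spectral_diag A))
  *m spectralmx A.

(** [Tr chi_J(A)]; for self-adjoint [A] this trace is a real number. *)
Definition spectral_count (J : set R) N (A : 'M[R[i]]_N) : R :=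
  complex.Re (\tr (mxcalc \1_J A)).

End Operators.

Section AlloyModel.
Context {R : realType} {d : nat}.
Implicit Types u w V : lattice d -> R.

(** Both sums have finitely many nonzero terms when [u] is finitely
    supported. *)
Definition potential_mean u : R := \sum_(k \in [set: lattice d]) u k.

Definition alloy_potential u w (x : lattice d) : R :=
  \sum_(k \in [set: lattice d]) w k * u (x - k).

Definition potential_rank u : nat := #|` fset_set [set k | u k != 0]|%fset.

(** The points of the cube [[0, L]^d] are enumerated by
    ['I_(cube_size L)], and vectors of [ell2] of the cube are row vectors. *)
Definition cube_size (L : nat) : nat := #|{ffun 'I_d -> 'I_L.+1}|.

Definition cube_site (L : nat) (i : 'I_(cube_size L)) : lattice d :=
  \row_j (enum_val i j : nat)%:Z.

Definition cube_incl (L : nat) (v : 'rV[R[i]]_(cube_size L)) :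
    lattice d -> R[i] :=
  fun k => \sum_(i | cube_site i == k) v 0 i.

Definition cube_restr (L : nat) (phi : lattice d -> R[i]) :
    'rV[R[i]]_(cube_size L) :=
  \row_i phi (cube_site i).

(** [lin1_mx] represents the operator by a matrix acting on row vectors from
    the right. *)
Definition cube_hamiltonian (H0 : (lattice d -> R[i]) -> (lattice d -> R[i]))
    V (L : nat) : 'M[R[i]]_(cube_size L) :=
  lin1_mx (fun v => cube_restr L (H0 (cube_incl v))
                    + \row_i ((V (cube_site i))%:C * v 0 i)).

End AlloyModel.
Arguments cube_size d L : clear implicits.

Section Densities.
Context {R : realType}.

(** Total variation on the whole real line; on integrable functions, in
    particular on probability densities, it is a norm. *)
Definition BV_norm (f : R -> R) : \bar R :=
  ereal_sup [set total_variation ab.1 ab.2 f |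
              ab in [set ab : R * R | ab.1 <= ab.2]].

Definition BV_line (f : R -> R) : Prop := (BV_norm f < +oo)%E.

Context {disp : measure_display} {T : measurableType disp}.
Implicit Types P : probability T R.

Definition has_density P (X : {RV P >-> R}) (f : R -> R) : Prop :=
  [/\ measurable_fun [set: R] f,
      forall x, 0 <= f x &
      forall B : set R, measurable B ->
        distribution P X B = (\int[lebesgue_measure]_(x in B) (f x)%:E)%E].

Definition mutually_independent P (I : choiceType)
    (X : I -> {RV P >-> R}) : Prop :=
  forall (s : seq I) (B : I -> set R), uniq s ->
    (forall k, measurable (B k)) ->
    P (\bigcap_(k in [set` s]) (X k @^-1` B k))
      = (\big[*%E/1]_(k <- s) P (X k @^-1` B k))%E.

End Densities.

(* Main.v *)
Require Import Defs.
From HB Require Import structures.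
From mathcomp Require Import all_boot all_order all_algebra.
From mathcomp Require Import finmap complex zify ring lra.
From mathcomp Require Import all_classical all_reals all_analysis.
From mathcomp Require Import measurable_realfun.

(** The estimate compares the eigenvalue count of the cube Hamiltonian at two
    energies by moving the energy shift into the random potential.

    Write [N(V, E)] for the number of eigenvalues at most [E] of a fixed
    Hermitian matrix plus the diagonal potential [V]. Raising the energy by
    [delta] is the same as lowering the potential by the constant [delta]. On
    the cube the translates of [u] by the sites [k] add up to the constant
    [ubar], the mean of [u], so the constant potential [delta] arises from
    adding [sigma = delta / ubar] to every coupling constant that reaches the
    cube. The coupling constants are shifted one at a time.

    Changing a single coupling constant [omega_k] alters the potential on at
    most [r_k] sites of the cube, the number of those with [u (x - k) != 0],
    and therefore the count by at most [r_k] ([low_count_stable], a min-max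
    argument). Under the law of [omega_k], shifting the argument of a function
    that oscillates by at most [r_k] changes its integral by at most [r_k]
    times the L1 distance between the density [f] and its translate by
    [sigma], which is at most [|sigma|] times the total variation of [f]
    ([integral_translate_leN], [ge0_integral_nat_shift]). Independence lets the
    other coupling constants be frozen meanwhile ([ge0_integral_joint]).

    Summing over [k] gives [sum_k r_k = (L + 1)^d rank u]: each of the
    [(L + 1)^d] sites of the cube is reached by [rank u] coupling constants
    ([sum_site_rank]). Hence the expected number of eigenvalues in
    [(E, E + delta]] is at most
    [(L + 1)^d (rank u) |delta| ||f||_BV / |ubar|]. This is the Lipschitz
    bound; the closed interval [[E - eps, E + eps]] lies in
    [(E - 3 eps, E + eps]], of length [4 eps], and [L + 1 <= L + n]. Counting
    by sites instead of bounding each [r_k] by [rank u] over the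
    [(L + n + 1)^d] coupling constants is what yields the power of [L + n].

    Expectations of counts are manipulated through integrals, so the count must
    be a measurable function of the random potential. This follows from its
    monotonicity in the potential and its right continuity in the energy, by
    approximation with rational potentials ([measurable_low_count_ge]). *)
Import Order.TTheory GRing.Theory Num.Theory.
Import numFieldNormedType.Exports.

Local Open Scope classical_set_scope.
Local Open Scope ring_scope.

(** * Comparison of eigenvalue counts *)

Section SpectralSubspaces.
Context {C : numClosedFieldType} {N : nat}.
Local Open Scope sesquilinear_scope.
Implicit Types (A B : 'M[C]_N) (S : {set 'I_N}) (v : 'rV[C]_N) (e : C).

Definition quad_form A v : C := (v *m A *m v ^t*) 0 0.

Definition norm_sq v : C := (v *m v ^t*) 0 0.

(** The rows are orthonormal eigenvectors, those with index in [S]; vectors are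
    rows and matrices act from the right. *)
Definition eigen_rows A S : 'M[C]_(#|S|, N) :=
  rowsub enum_val (spectralmx A).

Definition low_spectrum A e : {set 'I_N} :=
  [set i | spectral_diag A 0 i <= e]%SET.

Definition count_le A e : nat := #|low_spectrum A e|.

Lemma eigen_rows_unitary A S : eigen_rows A S \is unitarymx.
Proof.
apply/row_unitarymxP => i j; rewrite !row_rowsub.
by rewrite (row_unitarymxP (spectral_unitarymx A)) (inj_eq enum_val_inj).
Qed.

Lemma rank_eigen_rows A S : \rank (eigen_rows A S) = #|S|.
Proof. exact/mxrank_unitary/eigen_rows_unitary. Qed.

Lemma spectral_rowE A : A \is hermsymmx ->
  spectralmx A *m A = diag_mx (spectral_diag A) *m spectralmx A.
Proof.
move=> /hermitian_normalmx /orthomx_spectralP {2}->.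
by rewrite !mulmxA mulmxV ?spectral_unit// mul1mx.
Qed.

(** Rows of the spectral matrix are eigenvectors, so on their span the quadratic
    form of [A] is diagonal in the coordinates [w]. *)
Lemma eigen_rows_mul A S : A \is hermsymmx ->
  eigen_rows A S *m A =
  diag_mx (colsub enum_val (spectral_diag A)) *m eigen_rows A S.
Proof.
move=> hA; rewrite /eigen_rows mul_rowsub_mx spectral_rowE//.
by apply/matrixP => i j; rewrite !mul_diag_mx !mxE.
Qed.

Lemma norm_sq_eigen A S (w : 'rV[C]_#|S|) :
  norm_sq (w *m eigen_rows A S) = \sum_j w 0 j * (w 0 j)^*.
Proof.
rewrite /norm_sq trmx_mul map_mxM mulmxA -(mulmxA w).
rewrite (unitarymxP (eigen_rows_unitary A S)) mulmx1 mxE.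
by apply: eq_bigr => j _; rewrite !mxE.
Qed.

Lemma quad_form_eigen A S (w : 'rV[C]_#|S|) : A \is hermsymmx ->
  quad_form A (w *m eigen_rows A S) =
  \sum_j spectral_diag A 0 (enum_val j) * (w 0 j * (w 0 j)^*).
Proof.
move=> hA; rewrite /quad_form -(mulmxA w) eigen_rows_mul//.
rewrite trmx_mul map_mxM !mulmxA -(mulmxA (w *m _)).
rewrite (unitarymxP (eigen_rows_unitary A S)) mulmx1 mxE.
apply: eq_bigr => j _; rewrite mul_mx_diag !mxE mulrA; congr (_ * _).
by rewrite mulrC.
Qed.

Lemma quad_form_le A e v : A \is hermsymmx ->
  (v <= eigen_rows A (low_spectrum A e))%MS ->
  quad_form A v <= e * norm_sq v.
Proof.
move=> hA /submxP[w ->]; rewrite quad_form_eigen// norm_sq_eigen mulr_sumr.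
apply: ler_sum => j _; apply: ler_wpM2r; first exact: mul_conjC_ge0.
by have := enum_valP j; rewrite inE.
Qed.

Lemma quad_form_gt A e v : A \is hermsymmx -> e \is Num.real -> v != 0 ->
  (v <= eigen_rows A (~: low_spectrum A e))%MS ->
  e * norm_sq v < quad_form A v.
Proof.
move=> hA eR v0 /submxP[w vw].
have gtD (j : 'I_#|~: low_spectrum A e|) : e < spectral_diag A 0 (enum_val j).
  have := enum_valP j; rewrite !inE real_leNgt ?negbK//.
  exact: (mxOverP (hermitian_spectral_diag_real hA)).
have /existsP[j wj] : [exists j, w 0 j != 0].
  apply: contraNT v0; rewrite negb_exists => /forallP w0.
  rewrite vw (_ : w = 0) ?mul0mx//; apply/rowP => j; rewrite mxE.
  by apply/eqP; rewrite -[_ == _]negbK w0.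
rewrite vw quad_form_eigen// norm_sq_eigen mulr_sumr.
have term_ge0 i : 0 <= w 0 i * (w 0 i)^* by exact: mul_conjC_ge0.
rewrite (bigD1 j)//= [ltRHS](bigD1 j)//=; apply: ltr_leD.
  by rewrite ltr_pM2r// mul_conjC_gt0.
by apply: ler_sum => i _; apply: ler_wpM2r => //; exact: ltW.
Qed.

(** Weyl inequality by dimension count. If the left side were larger, the span
    of the eigenvectors of [A] with eigenvalue at most [eA], the kernel of [K]
    and the span of the eigenvectors of [B] with eigenvalue above [eB] would
    meet in a nonzero vector, on which the assumed inequality between the
    shifted quadratic forms fails. *)
Lemma count_le_rank A B eA eB m (K : 'M[C]_(N, m)) :
  A \is hermsymmx -> B \is hermsymmx -> eB \is Num.real ->
  (forall v, v *m K = 0 ->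
    quad_form B v - eB * norm_sq v <= quad_form A v - eA * norm_sq v) ->
  (count_le A eA <= count_le B eB + \rank K)%N.
Proof.
move=> hA hB eBR qBA; rewrite leqNgt; apply/negP => lt_ba.
set U := eigen_rows A (low_spectrum A eA).
set W := eigen_rows B (~: low_spectrum B eB).
have rU : \rank U = count_le A eA by exact: rank_eigen_rows.
have rW : (\rank W + count_le B eB)%N = N.
  by rewrite rank_eigen_rows addnC cardsC card_ord.
have : (U :&: kermx K :&: W)%MS != 0.
  rewrite -mxrank_eq0 -lt0n.
  have := mxrank_sum_cap U (kermx K).
  have := mxrank_sum_cap (U :&: kermx K)%MS W.
  have := rank_leq_col (U :&: kermx K + W)%MS.
  have := rank_leq_col (U + kermx K)%MS.
  have := rank_leq_row K.
  rewrite mxrank_ker; lia.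
case/rowV0Pn => v; rewrite !sub_capmx => /andP[/andP[vU /sub_kermxP vK] vW] v0.
have leA : quad_form A v - eA * norm_sq v <= 0.
  by rewrite subr_le0; exact: quad_form_le.
have gtB : 0 < quad_form B v - eB * norm_sq v.
  by rewrite subr_gt0; exact: quad_form_gt.
by have := lt_le_trans gtB (le_trans (qBA v vK) leA); rewrite ltxx.
Qed.

End SpectralSubspaces.

Section PotentialPerturbation.
Context {R : realType} {N : nat}.
Implicit Types (M : 'M[R[i]]_N) (V W : 'I_N -> R) (E F : R).
Local Open Scope complex_scope.

Definition add_potential M V : 'M[R[i]]_N := M + diag_mx (\row_i (V i)%:C).

Definition low_count M V E : nat := count_le (add_potential M V) E%:C.

Lemma real_complex_real (x : R) : x%:C \is Num.real.
Proof. by apply/complex_realP; exists x. Qed.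

Lemma add_potential_herm M V : M \is hermsymmx -> add_potential M V \is hermsymmx.
Proof.
move=> /is_hermitianmxP; rewrite expr0 scale1r => hM.
apply/is_hermitianmxP; rewrite expr0 scale1r /add_potential raddfD/= map_mxD -hM.
congr (_ + _); apply/matrixP => i j; rewrite !mxE.
have [->|ij] := eqVneq i j; last by rewrite !mulr0n raddf0.
by rewrite !mulr1n; apply/esym/CrealP/real_complex_real.
Qed.

Lemma quad_form_potential M V E v :
  quad_form (add_potential M V) v - E%:C * norm_sq v =
  quad_form M v + \sum_i (V i - E)%:C * (v 0 i * (v 0 i)^*%R).
Proof.
rewrite /quad_form /norm_sq /add_potential mulmxDr mulmxDl mxE -addrA; congr (_ + _).
rewrite mul_mx_diag !mxE mulr_sumr -sumrB; apply: eq_bigr => i _.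
rewrite !mxE rmorphB/= mulrBl; congr (_ - _).
by rewrite -mulrA mulrCA mulrA.
Qed.

(** One statement for three uses of min-max. With [S] empty it gives
    monotonicity in the potential and in the energy; with [E = F] and [V], [W]
    equal off [S] it is the stability of the count under a perturbation of rank
    at most [#|S|]. The kernel of [K] consists of the vectors vanishing on
    [S]. *)
Lemma low_count_stable M (S : {set 'I_N}) V W E F : M \is hermsymmx ->
  (forall i, i \notin S -> W i - F <= V i - E) ->
  (low_count M V E <= low_count M W F + #|S|)%N.
Proof.
move=> hM leVW; pose K := colsub enum_val 1%:M : 'M[R[i]]_(N, #|S|).
apply: (@leq_trans (low_count M W F + \rank K)%N); last first.
  by rewrite leq_add2l rank_leq_col.
apply: count_le_rank => [|||v vK]; rewrite ?real_complex_real ?add_potential_herm//.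
rewrite !quad_form_potential lerD2l; apply: ler_sum => i _.
have [iS|iS] := boolP (i \in S); last first.
  by rewrite ler_wpM2r ?mul_conjC_ge0// lecR; exact: leVW.
have : (v *m K) 0 (enum_rank_in iS i) = 0 by rewrite vK mxE.
rewrite mulmx_colsub mulmx1 mxE enum_rankK_in// => ->.
by rewrite mul0r !mulr0.
Qed.

Lemma low_count_shift M V c E : M \is hermsymmx ->
  low_count M (fun i => V i + c) E = low_count M V (E - c).
Proof.
move=> hM; apply/eqP; rewrite eqn_leq.
rewrite -[X in (_ <= X)%N && _]addn0 -[X in _ && (_ <= X)%N]addn0 -(cards0 'I_N).
by apply/andP; split; apply: low_count_stable => // i _; rewrite opprB addrA addrAC.
Qed.

Lemma in_low_spectrum (A : 'M[R[i]]_N) E i : A \is hermsymmx ->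
  (i \in low_spectrum A E%:C) = (complex.Re (spectral_diag A 0 i) <= E).
Proof.
move=> hA; rewrite inE -[in LHS](RRe_real (_ : spectral_diag A 0 i \is Num.real)) ?lecR//.
by have /mxOverP := hermitian_spectral_diag_real hA.
Qed.

(** The eigenvalues above [E] are finitely many, so some [1 / (m + 1)] fits
    below all the gaps between them and [E]. *)
Lemma low_count_right_continuous M V E (n : nat) : M \is hermsymmx ->
  (forall m : nat, (n <= low_count M V (E + m.+1%:R^-1))%N) ->
  (n <= low_count M V E)%N.
Proof.
move=> hM len; have hA := add_potential_herm _ V hM.
pose D i := complex.Re (spectral_diag (add_potential M V) 0 i).
have gap (i : 'I_N) : exists m : nat, E < D i ->
    forall k, (m <= k)%N -> E + k.+1%:R^-1 < D i.
  have [DE|/ltr_add_invr[m ltm]] := leP (D i) E; first by exists 0%N.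
  exists m => _ k mk; apply: le_lt_trans ltm.
  by rewrite lerD2l lef_pV2 ?posrE// ler_nat ltnS.
pose m := \max_i projT1 (cid (gap i)).
apply: leq_trans (len m) _; apply: subset_leq_card; apply/fintype.subsetP => i.
rewrite !in_low_spectrum//; apply: contraLR; rewrite -!ltNge => EDi.
by apply: (projT2 (cid (gap i)) EDi); exact: leq_bigmax.
Qed.

Lemma spectral_countE (J : set R) (A : 'M[R[i]]_N) :
  spectral_count J A = \sum_i \1_J (complex.Re (spectral_diag A 0 i)).
Proof.
rewrite /spectral_count /mxcalc mxtrace_mulC mulmxA mulmxV ?spectral_unit// mul1mx.
rewrite mxtrace_diag raddf_sum; apply: eq_bigr => i _.
by rewrite mxE.
Qed.

Lemma spectral_count_le M V E : M \is hermsymmx ->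
  spectral_count `]-oo, E] (add_potential M V) = (low_count M V E)%:R.
Proof.
move=> hM; rewrite spectral_countE /low_count /count_le -sum1_card natr_sum.
rewrite [RHS]big_mkcond/=; apply: eq_bigr => i _; rewrite indicE.
by rewrite in_low_spectrum ?add_potential_herm// mem_setE in_itv/=; case: ifP.
Qed.

(** The energy [E - 3 eps] is one choice below [E - eps]; a strictly smaller
    lower end is needed since the count at the lower end includes the
    eigenvalues equal to it. It makes the length of the half-open interval
    [4 eps]. *)
Lemma spectral_count_itv M V (E eps : R) : M \is hermsymmx -> 0 < eps ->
  spectral_count `[E - eps, E + eps] (add_potential M V)
    + (low_count M V (E - 3 * eps))%:R
  <= (low_count M V (E + eps))%:R.
Proof.
move=> hM eps0; rewrite -!spectral_count_le// !spectral_countE -big_split/=.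
apply: ler_sum => i _; set x := complex.Re _; rewrite !indicE !mem_setE !in_itv/=.
case: (leP x (E + eps)) => [xle|xgt].
  rewrite andbT; case: (leP (E - eps) x) => [ltx|]; last by rewrite add0r ler_nat leq_b1.
  have -> : (x <= E - 3 * eps) = false by apply/negbTE; rewrite -ltNge; lra.
  by rewrite addr0.
have -> : (x <= E - 3 * eps) = false by apply/negbTE; rewrite -ltNge; lra.
by rewrite andbF addr0.
Qed.

Lemma spectral_count_ge0 J (A : 'M[R[i]]_N) : 0 <= spectral_count J A.
Proof. by rewrite spectral_countE; apply: sumr_ge0 => i _; rewrite indicE. Qed.

End PotentialPerturbation.

(** * Measurability of the eigenvalue count *)

(** Writing a bounded natural number as a sum of indicators reduces
    measurability and integrals of counts to those of their superlevel sets. *)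
Lemma layer_cake (c r : nat) : (c <= r)%N -> c = (\sum_(j < r) (j < c))%N.
Proof.
move=> cr; under eq_bigr do rewrite -[nat_of_bool _]/(if _ then 1 else 0)%N.
by rewrite -big_mkcond -(big_ord_widen r (fun=> 1%N))// sum1_card card_ord.
Qed.

Lemma measurable_natr {R : realType} {disp : measure_display}
    {S : measurableType disp} (D : S -> nat) (b : nat) :
  (forall s, (D s <= b)%N) -> (forall n, measurable [set s | (n <= D s)%N]) ->
  measurable_fun [set: S] (fun s => (D s)%:R : R).
Proof.
move=> Db mD.
rewrite (_ : (fun s => _) = fun s => \sum_(j < b)
    \1_[set s | (j.+1 <= D s)%N] s); last first.
  apply/funext => s; rewrite [X in X%:R](layer_cake _ _ (Db s)) natr_sum.
  by apply: eq_bigr => j _; rewrite indicE mem_setE.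
by apply: measurable_sum => j; exact: measurable_indic.
Qed.

Section MeasurableCount.
Context {R : realType} {N : nat} {disp : measure_display} {S : measurableType disp}.
Variables (M : 'M[R[i]]_N) (V : S -> 'I_N -> R).
Hypothesis herm_M : M \is hermsymmx.
Hypothesis mV : forall i, measurable_fun [set: S] (V^~ i).

(** The superlevel set is a countable combination of boxes: by monotonicity the
    count at [V s] and energy [E] is sandwiched between counts at a rational
    potential within [1 / (m + 1)] of [V s] and energies at most
    [2 / (m + 1)] above [E], and right continuity removes the error. *)
Lemma measurable_low_count_ge E n :
  measurable [set s | (n <= low_count M (V s) E)%N].
Proof.
pose near (q : {ffun 'I_N -> rat}) (m : nat) : set S :=
  \bigcap_(i in [set: 'I_N]) [set s | `|V s i - ratr (q i)| <= m.+1%:R^-1].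
pose good (m : nat) (q : {ffun 'I_N -> rat}) :=
  (n <= low_count M (fun i => ratr (q i)) (E + m.+1%:R^-1))%N.
have -> : [set s | (n <= low_count M (V s) E)%N] =
    \bigcap_m \bigcup_(q : {ffun 'I_N -> rat}) (near q m `&` [set _ | good m q]).
  apply/seteqP; split => [s /= ns m _|s /= H].
    have m0 : 0 < m.+1%:R^-1 :> R by rewrite invr_gt0.
    have appr i : exists q : rat, ratr q \in `]V s i, (V s i + m.+1%:R^-1)[.
      by apply: rat_in_itvoo; rewrite ltrDl.
    have [q Vq] := choice appr; exists [ffun i => q i] => //; split.
      move=> i _ /=; rewrite ffunE; have := Vq i; rewrite in_itv/=.
      move: (ratr _) (_.+1%:R^-1) m0 => r eta eta0 /andP[lo up]; rewrite ler_distl.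
      by apply/andP; split; lra.
    apply: (leq_trans ns); rewrite -[leqRHS]addn0 -(cards0 'I_N).
    apply: low_count_stable => // i _; rewrite ffunE; have := Vq i; rewrite in_itv/=.
    by move: (ratr _) (_.+1%:R^-1) m0 => r eta eta0 /andP[lo up]; lra.
  apply: low_count_right_continuous => // k.
  (* Going from [V s] to [q] and from [E] to the energy of [good] each costs
     [1 / (m + 1)]; with [m = 2 k + 1] the total is [1 / (k + 1)]. *)
  have [q _ [qV qn]] := H (k.*2.+1) I.
  apply: (leq_trans qn); rewrite -[leqRHS]addn0 -(cards0 'I_N).
  apply: low_count_stable => // i _; have /= := qV i I; rewrite ler_distl.
  move: (ratr _) => r /andP[lo up].
  have -> : k.+1%:R^-1 = 2 * k.*2.+2%:R^-1 :> R.
    rewrite (_ : k.*2.+2 = 2 * k.+1)%N; last by rewrite mul2n.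
    by rewrite natrM invfM mulrA divff ?mul1r.
  by move: (_.+2%:R^-1) lo up => eta lo up; lra.
apply: bigcapT_measurable => m; apply: countable_bigcupT_measurable => [|q].
  exact: countableP.
apply: measurableI; last first.
  by case: (good m q); rewrite ?set_true ?set_false; [exact: measurableT|exact: measurable0].
apply: fin_bigcap_measurable => // i _.
rewrite (_ : [set _ | _] = V^~ i @^-1` `[ratr (q i) - m.+1%:R^-1, ratr (q i) + m.+1%:R^-1]).
  by rewrite -[X in measurable X]setTI; apply: mV => //; exact: measurable_itv.
by apply/seteqP; split => s /=; rewrite in_itv/= ler_distl.
Qed.

Lemma low_count_leN E (W : 'I_N -> R) : (low_count M W E <= N)%N.
Proof. by rewrite -[leqRHS]card_ord max_card. Qed.

Lemma measurable_low_count E :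
  measurable_fun [set: S] (fun s => (low_count M (V s) E)%:R : R).
Proof.
apply: (@measurable_natr _ _ _ _ N) => [s|n]; first exact: low_count_leN.
exact: measurable_low_count_ge.
Qed.

End MeasurableCount.

(** * Translates of functions of bounded variation *)

Section Translation.
Context {R : realType}.
Local Notation mu := (@lebesgue_measure R).
Local Open Scope ereal_scope.

Lemma measurable_addr (s : R) : measurable_fun [set: R] (fun x : R => x + s)%R.
Proof. exact: measurable_funD. Qed.

Lemma lebesgue_measure_shift (s : R) (A : set R) : measurable A ->
  pushforward mu ((fun x => x + s)%R : _ -> measurableTypeR R) A = mu A.
Proof.
move=> mA; apply/esym/lebesgue_measure_unique => [|ms|//]; first exact: measurable_addr.
move=> _ [[a b] _ <-] /=; rewrite /pushforward.
rewrite (_ : _ @^-1` _ = `](a - s)%R, (b - s)%R]%classic).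
  rewrite !lebesgue_measure_itv/= !lte_fin ltrD2r -!EFinB.
  by case: ifP => //= _; congr (_%:E); lra.
by apply/seteqP; split => x /=; rewrite !in_itv/= ltrBlDr lerBrDr.
Qed.

Lemma ge0_integral_shift (s : R) (h : R -> \bar R) :
  measurable_fun [set: R] h -> (forall x, 0 <= h x) ->
  \int[mu]_x h (x + s)%R = \int[mu]_x h x.
Proof.
move=> mh h0; have ms := measurable_addr s.
transitivity (\int[pushforward mu ((fun x => x + s)%R : _ -> measurableTypeR R)]_x h x).
  by rewrite ge0_integral_pushforward.
by apply: eq_measure_integral => //= A mA _; exact: lebesgue_measure_shift.
Qed.

End Translation.

Section VariationOfTranslates.
Context {R : realType}.
Local Notation mu := (@lebesgue_measure R).
Local Open Scope ereal_scope.
Variable f : R -> R.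
Hypothesis mf : measurable_fun [set: R] f.

Lemma BV_norm_ge a b : (a <= b)%R -> total_variation a b f <= BV_norm f.
Proof. by move=> ab; apply: ereal_sup_ubound; exists (a, b). Qed.

Lemma BV_norm_ge0 : 0 <= BV_norm f.
Proof. by rewrite -(total_variationxx 0 f); exact: BV_norm_ge. Qed.

(** The points [y + j s] partition an interval, and the sum is at most the
    variation of [f] over this partition. *)
Lemma sum_increments_le (s y : R) (K : nat) : (0 <= s)%R ->
  \sum_(j < K) `|f (y + j.+1%:R * s) - f (y + j%:R * s)|%:E <= BV_norm f.
Proof.
move=> s0; apply: (@le_trans _ _ (total_variation y (y + K%:R * s)%R f)); last first.
  by apply: BV_norm_ge; rewrite lerDl mulr_ge0.
elim: K => [|K IH]; first by rewrite big_ord0 mul0r addr0 total_variationxx.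
have le1 : (y <= y + K%:R * s)%R by rewrite lerDl mulr_ge0.
have le2 : (y + K%:R * s <= y + K.+1%:R * s)%R by rewrite lerD2l ler_wpM2r// ler_nat.
rewrite big_ord_recr/= (total_variationD _ le1 le2); apply: leeD => //.
exact: total_variation_ge.
Qed.

Let g (s x : R) : \bar R := (`|f (x + s) - f x|)%:E.

Let mg s : measurable_fun [set: R] (g s).
Proof.
apply/measurable_EFinP/measurableT_comp => //; apply: measurable_funB => //.
exact: (measurableT_comp mf (measurable_addr s)).
Qed.

Let g0 s x : 0 <= g s x. Proof. by rewrite lee_fin. Qed.

(** Folding the line modulo [s]: the windows of length [s] are translated onto
    [[0, s[], where increments along an arithmetic progression appear under a
    single integral. *)
Lemma integral_translate_window (s a : R) (K : nat) : (0 <= s)%R ->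
  \int[mu]_(x in `[a, (a + K%:R * s)%R[) g s x =
  \int[mu]_(x in `[0%R, s[) \sum_(j < K) g s (x + (a + j%:R * s))%R.
Proof.
move=> s0; rewrite ge0_integral_sum//=; last first.
  move=> j; apply: measurable_funTS.
  exact: (measurableT_comp (mg s) (measurable_addr _)).
elim: K => [|K IH]; first by rewrite big_ord0 mul0r addr0 set_itvco0 integral_set0.
have le1 : (a <= a + K%:R * s)%R by rewrite lerDl mulr_ge0.
have le2 : (a + K%:R * s <= a + K.+1%:R * s)%R by rewrite lerD2l ler_wpM2r// ler_nat.
rewrite big_ord_recr/= -IH.
rewrite (@itv_bndbnd_setU _ _ _ (BLeft (a + K%:R * s)%R)) ?bnd_simp//.
rewrite ge0_integral_setU//=.
- congr (_ + _).
  rewrite [LHS]integral_mkcond [RHS]integral_mkcond -(ge0_integral_shift (a + K%:R * s)).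
  + apply: eq_integral => x _; rewrite !patchE !mem_setE !in_itv/=.
    have -> : (x + (a + K%:R * s) < a + K.+1%:R * s)%R = (x < s)%R.
      by rewrite -natr1 mulrDl mul1r addrCA ltrD2l addrC ltrD2l.
    by rewrite lerDr.
  + by apply/(measurable_restrictT (g s)) => //; exact: (measurable_funTS (mg s)).
  + by move=> x; apply: erestrict_ge0.
- exact: (measurable_funTS (mg s)).
- apply/disj_setPS => x [] /=; rewrite !in_itv/= => /andP[_ lt1] /andP[le2' _].
  by move: lt1; rewrite ltNge le2'.
Qed.

(** Folded modulo [s], the integrand becomes a sum of increments of [f] along
    an arithmetic progression, bounded by the total variation at each point of
    [[0, s[]; the line is exhausted by the windows [W]. *)
Lemma integral_translate_le (s : R) : (0 <= s)%R ->
  \int[mu]_x g s x <= s%:E * BV_norm f.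
Proof.
rewrite le_eqVlt => /predU1P[<-|s0].
  rewrite mul0e integral0_eq// => x _.
  by rewrite /g addr0 subrr normr0.
pose W (K : nat) := `[(- K%:R * s)%R, (- K%:R * s + (2 * K)%:R * s)%R[%classic.
have WE K : W K = `[(- (K%:R * s))%R, (K%:R * s)%R[%classic.
  rewrite /W mulNr (_ : - (K%:R * s) + (2 * K)%:R * s = K%:R * s)%R//.
  by rewrite natrM; lra.
have UW : \bigcup_K W K = setT.
  apply/seteqP; split => // x _; exists (Num.bound (`|x| / s)) => //.
  rewrite WE /= in_itv/=.
  have /archi_boundP : (0 <= `|x| / s)%R by rewrite divr_ge0// ltW.
  rewrite ltr_pdivrMr// => /ltr_normlP[lt1 lt2]; rewrite lt2 andbT.
  by rewrite lerNl ltW.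
have cvgW : \int[mu]_(x in W K) g s x @[K --> \oo] --> \int[mu]_x g s x.
  rewrite -UW; apply: ge0_nondecreasing_set_cvg_integral.
  - move=> m n mn; apply/subsetPset; rewrite !WE => x /=; rewrite !in_itv/=.
    have : (m%:R * s <= n%:R * s)%R by rewrite ler_wpM2r ?ler_nat// ltW.
    by move=> le /andP[? ?]; apply/andP; split; lra.
  - by move=> n; exact: measurable_itv.
  - by move=> n; exact: (measurable_funTS (mg s)).
  - by move=> n x _.
rewrite -(cvg_lim _ cvgW)//; apply: lime_le.
  by apply/cvg_ex; exists (\int[mu]_x g s x).
apply: nearW => K; rewrite /W (integral_translate_window s _ _ (ltW s0)).
apply: (@le_trans _ _ (\int[mu]_(x in `[0%R, s[) BV_norm f)).
  apply: ge0_le_integral => //=.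
  - by move=> x _; exact: sume_ge0.
  - apply: measurable_funTS; apply: emeasurable_sum => j.
    exact: (measurableT_comp (mg s) (measurable_addr _)).
  - move=> x _; apply: le_trans (sum_increments_le s (x - K%:R * s) (2 * K) (ltW s0)).
    apply: lee_sum => j _; rewrite /g lee_fin le_eqVlt; apply/orP; left; apply/eqP.
    by congr (`|f _ - f _|)%R; rewrite -?natr1; lra.
rewrite integral_cst//= lebesgue_measure_itv/= lte_fin s0 oppr0 adde0.
by rewrite muleC.
Qed.

Lemma integral_translate_leN (s : R) :
  \int[mu]_x g s x <= `|s|%:E * BV_norm f.
Proof.
have [s0|s0] := leP 0%R s; first by rewrite ger0_norm// integral_translate_le.
rewrite ltr0_norm// -(ge0_integral_shift (- s)) //=.
apply: le_trans (integral_translate_le (- s) _); last by rewrite oppr_ge0 ltW.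
by rewrite le_eqVlt; apply/orP; left; apply/eqP/eq_integral => x _; rewrite /g subrK distrC.
Qed.

End VariationOfTranslates.

Section ShiftedDistribution.
Context {R : realType} {disp : measure_display} {T : measurableType disp}.
Variables (P : probability T R) (X : {RV P >-> R}) (f : R -> R).
Local Notation mu := (@lebesgue_measure R).
Local Open Scope ereal_scope.
Hypothesis fX : has_density X f.

(** The two probabilities are integrals over [B] of [f] and of its translate,
    whose difference is at most the L1 distance of [f] and its translate. *)
Lemma distribution_shift_le (s : R) (B : set R) : measurable B ->
  distribution P X ((fun x => x + s)%R @^-1` B)
  <= distribution P X B + `|s|%:E * BV_norm f.
Proof.
move=> mB; have [mf f0 PX] := fX.
have mBs : measurable ((fun x => x + s)%R @^-1` B).
  by rewrite -[X in measurable X]setTI; exact: measurable_addr.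
have mf1 : measurable_fun [set: R] (fun x => (f x)%:E) by exact/measurable_EFinP.
have mfB : measurable_fun [set: R] ((fun x => (f x)%:E) \_ B).
  by apply/(measurable_restrictT (fun x => (f x)%:E)) => //; exact: (measurable_funTS mf1).
have mfs : measurable_fun [set: R] (fun x => f (x - s))%R.
  exact: (measurableT_comp mf (measurable_addr _)).
have BsE (x : R) : ((x - s)%R \in (fun x => x + s)%R @^-1` B) = (x \in B).
  by apply/idP/idP; rewrite !inE /= subrK.
pose fs (x : R) := (f (x - s))%:E.
have mfs1 : measurable_fun [set: R] fs by exact/measurable_EFinP.
have mfsB : measurable_fun [set: R] (fs \_ B).
  by apply/(measurable_restrictT fs) => //; exact: (measurable_funTS mfs1).
rewrite !PX// [leLHS]integral_mkcond -(ge0_integral_shift (- s)); last 2 first.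
- by apply/(measurable_restrictT (fun x => (f x)%:E)) => //; exact: (measurable_funTS mf1).
- by move=> x; apply: erestrict_ge0 => y _; rewrite lee_fin.
rewrite [in leRHS]integral_mkcond -(normrN s).
apply: le_trans (leeD2l _ (integral_translate_leN f mf (- s))).
have mg : measurable_fun [set: R] (fun x => `|f (x - s) - f x|%:E)%R.
  by apply/measurable_EFinP/measurableT_comp => //; exact: measurable_funB.
rewrite -ge0_integralD//=; last first.
  by move=> x _; apply: erestrict_ge0 => y _; rewrite lee_fin.
apply: ge0_le_integral => //=.
- by move=> x _; apply: erestrict_ge0 => y _; rewrite lee_fin.
- rewrite (_ : (fun x => _) = fs \_ B) //.
  by apply/funext => x; rewrite !patchE BsE.
- exact: emeasurable_funD.
move=> x _; rewrite !patchE BsE.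
case: ifP => _; rewrite -?EFinD lee_fin ?add0r//.
by rewrite -lerBlDl ler_norm.
Qed.

(** Relative to its minimum [c], the function [h] is a sum of [r] indicators,
    and each superlevel set contributes one error term. Subtracting [c] first
    makes the bound depend on the oscillation of [h] and not on its size. *)
Lemma ge0_integral_nat_shift (s : R) (h : R -> nat) (r : nat) :
  (forall n, measurable [set x | (n <= h x)%N]) ->
  (forall x y, (h x <= h y + r)%N) ->
  \int[distribution P X]_x (h (x + s)%R)%:R%:E
  <= \int[distribution P X]_x (h x)%:R%:E + r%:R%:E * (`|s|%:E * BV_norm f).
Proof.
move=> mh osc.
have [c hc] : exists c, forall x, (c <= h x <= c + r)%N.
  have ex : exists n, (fun n => `[< exists x, h x = n >]) n.
    by exists (h 0%R); apply/asboolP; exists 0%R.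
  case: (ex_minnP ex) => c /asboolP[x0 hx0] cmin; exists c => x.
  rewrite -hx0 osc andbT hx0; apply: cmin; apply/asboolP; by exists x.
have hE x : (h x)%:R%:E = c%:R%:E +
    \sum_(j < r) (\1_[set y | (c + j < h y)%N] x)%:E :> \bar R.
  have /andP[cx xr] := hc x.
  rewrite -{1}(subnKC cx) natrD EFinD; congr (_ + _).
  rewrite (layer_cake (h x - c) r) ?leq_subLR// natr_sum -sumEFin.
  by apply: eq_bigr => j _; rewrite indicE mem_setE ltn_subRL.
have mS j : measurable [set y | (c + j < h y)%N] by exact: mh.
have intE t : \int[distribution P X]_x (h (x + t)%R)%:R%:E = c%:R%:E +
    \sum_(j < r) distribution P X ((fun x => x + t)%R @^-1` [set y | (c + j < h y)%N]).
  have mt j : measurable ((fun x => x + t)%R @^-1` [set y | (c + j < h y)%N]).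
    by rewrite -[X in measurable X]setTI; apply: measurable_addr.
  have mI j : measurable_fun [set: R]
      (fun x => (\1_[set y | (c + j < h y)%N] (x + t)%R : R)%:E).
    have m1 : measurable_fun [set: R] (\1_[set y | (c + j < h y)%N] : R -> R).
      exact: measurable_indic.
    apply/measurable_EFinP; exact: (measurableT_comp m1 (measurable_addr t)).
  under eq_integral do rewrite hE.
  rewrite ge0_integralD//=; last 2 first.
  - by move=> x _; apply: sume_ge0.
  - exact: emeasurable_sum.
  rewrite integral_cst//= probability_setT mule1 ge0_integral_sum//=.
  congr (_ + _); apply: eq_bigr => j _.
  by rewrite (integral_indic _ measurableT (mt j)) setIT.
rewrite intE (_ : \int[distribution P X]_x (h x)%:R%:E =
  \int[distribution P X]_x (h (x + 0)%R)%:R%:E); last first.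
  by apply: eq_integral => x _; rewrite addr0.
have E0 j : (fun x => x + 0)%R @^-1` [set y | (c + j < h y)%N] = [set y | (c + j < h y)%N].
  by apply/seteqP; split => x /=; rewrite addr0.
rewrite intE.
rewrite -addeA; apply: leeD2l.
rewrite [X in _ <= _ + X](_ : _ = \sum_(j < r) (`|s|%:E * BV_norm f)); last first.
  by rewrite mule_natl sumr_const card_ord.
rewrite -big_split/=; apply: lee_sum => j _; rewrite E0.
exact: distribution_shift_le.
Qed.

End ShiftedDistribution.

(** * Resampling one independent variable *)

Section IndependentCoordinate.
Context {R : realType} {disp : measure_display} {T : measurableType disp}.
Context {I : choiceType} (P : probability T R) (X : I -> {RV P >-> R}) (k : I).
Hypothesis indX : mutually_independent X.
Local Open Scope ereal_scope.

Definition other_cylinders : set (set T) :=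
  [set A | exists (s : seq I) (B : I -> set R), [/\ uniq s, k \notin s,
    forall j, measurable (B j) & A = \bigcap_(j in [set` s]) (X j @^-1` B j)]].

(** The sample space with the sigma-algebra generated by the variables other
    than [X k]. Freezing these variables means integrating over this space,
    which avoids a product space indexed by the remaining variables. *)
Definition other_coordinates : Type := g_sigma_algebraType other_cylinders.

HB.instance Definition _ := Measurable.on other_coordinates.

(** The identity, seen as the measurable map to the coarser sigma-algebra. *)
Definition forget : T -> other_coordinates := id.

Lemma other_cylinders_measurable : other_cylinders `<=` measurable.
Proof.
move=> _ [s [B [_ _ mB ->]]]; apply: fin_bigcap_measurable => // j _.
by rewrite -[X in measurable X]setTI; exact: measurable_funP.
Qed.

Lemma measurable_forget : measurable_fun [set: T] forget.
Proof.
move=> _ A mA; rewrite setTI; move: A mA; apply: smallest_sub.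
  exact: sigma_algebra_measurable.
exact: other_cylinders_measurable.
Qed.

HB.instance Definition _ := isMeasurableFun.Build _ _ _ _ forget measurable_forget.

Lemma other_cylinders_setI : setI_closed other_cylinders.
Proof.
move=> _ _ [s1 [B1 [u1 k1 m1 ->]]] [s2 [B2 [u2 k2 m2 ->]]].
exists (undup (s1 ++ s2)), (fun j => (if j \in s1 then B1 j else setT) `&`
  (if j \in s2 then B2 j else setT)); split.
- exact: undup_uniq.
- by rewrite mem_undup mem_cat negb_or k1.
- by move=> j; apply: measurableI; case: ifP.
apply/seteqP; split => t /=.
  move=> [H1 H2] j /=; rewrite mem_undup mem_cat => _; split.
    by case: ifPn => // js; exact: H1.
  by case: ifPn => // js; exact: H2.
move=> H; split=> j /= js; have /(_ j) := H; rewrite /= mem_undup mem_cat js ?orbT.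
  by move=> /(_ isT)[].
by move=> /(_ isT)[].
Qed.

Lemma measurable_other j : j != k ->
  measurable_fun [set: other_coordinates] (X j : other_coordinates -> R).
Proof.
move=> jk _ B mB; rewrite setTI; apply: sub_sigma_algebra.
exists [:: j], (fun=> B); split => //; first by rewrite inE eq_sym.
apply/seteqP; split => [t Bt i /=|t /(_ j)]; last by apply; rewrite /= inE.
by rewrite inE => /eqP ->.
Qed.

(** For fixed [B] both sides are finite measures in [C]. They agree on the
    pi-system of cylinders, which is the defining product rule, hence on the
    generated sigma-algebra. *)
Lemma coordinate_indep_others (B : set R) (C : set other_coordinates) :
  measurable B -> measurable C ->
  P (C `&` X k @^-1` B) = P (X k @^-1` B) * P C.
Proof.
move=> mB mC; have mXB : measurable (X k @^-1` B).
  by rewrite -[X in measurable X]setTI; exact: measurable_funP.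
have Pfin : P (X k @^-1` B) \is a fin_num by exact: fin_num_measure.
have p0 : (0 <= fine (P (X k @^-1` B)))%R by exact: fine_ge0.
pose m1 := pushforward (mrestr P mXB) forget.
pose m2 := mscale (NngNum p0) (distribution P forget).
have m2E A : m2 A = P (X k @^-1` B) * P A by rewrite /m2 /mscale /= fineK.
transitivity (m1 C) => //; rewrite -m2E.
move: C mC; apply: (@measure_unique _ _ other_coordinates other_cylinders
  (fun=> setT) _ _ _ _ m1 m2).
- by [].
- exact: other_cylinders_setI.
- by move=> _; exists [::], (fun=> setT); split => //; apply/seteqP; split.
- by apply/seteqP; split => // t _; exists 0%N.
- move=> _ [s [B' [us ks mB' ->]]].
  transitivity (m2 (\bigcap_(j in [set` s]) (X j @^-1` B' j))) => //; rewrite m2E.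
  rewrite /m1 /pushforward /mrestr.
  pose B'' j := if j == k then B else B' j.
  have kB : B'' k = B by rewrite /B'' eqxx.
  have sB j : j \in s -> B'' j = B' j.
    by move=> js; rewrite /B''; case: eqP => // jk; rewrite -jk js in ks.
  have mB'' j : measurable (B'' j) by rewrite /B''; case: ifP.
  have cylE : \bigcap_(j in [set` s]) (X j @^-1` B' j) =
              \bigcap_(j in [set` s]) (X j @^-1` B'' j).
    by apply: eq_bigcapr => j /= js; rewrite sB.
  have := indX (k :: s) B'' _ mB''; rewrite /= ks us big_cons -(indX s B'' us mB'').
  rewrite kB cylE => <-//; congr (P _).
  rewrite setIC; apply/seteqP; split => t /=.
    by move=> [tk ts] j; rewrite /= inE => /predU1P[->|/ts//]; rewrite kB.
  move=> H; split; first by rewrite -kB; apply: H; rewrite /= mem_head.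
  by move=> j /= js; apply: H; rewrite /= inE js orbT.
- move=> _; apply: (@le_lt_trans _ _ 1); last exact: ltry.
  apply: probability_le1; apply: measurableI => //; exact: measurableT.
Qed.

Let joint (t : T) : R * other_coordinates := (X k t, forget t).

Let measurable_joint : measurable_fun [set: T] joint.
Proof. by apply: measurable_fun_pair => //; exact: measurable_forget. Qed.

(** By [coordinate_indep_others] the joint law of [X k] and of the identity into
    the coarser space is a product measure, so Tonelli applies. *)
Lemma ge0_integral_joint (F : R * other_coordinates -> \bar R) :
  measurable_fun [set: R * other_coordinates] F -> (forall p, 0 <= F p) ->
  \int[P]_t F (X k t, t) =
  \int[distribution P forget]_t \int[distribution P (X k)]_x F (x, t).
Proof.
move=> mF F0; transitivity (\int[pushforward P joint]_p F p).
  by rewrite ge0_integral_pushforward.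
rewrite (@eq_measure_integral _ _ _ _ (distribution P (X k) \x distribution P forget)).
  by rewrite fubini_tonelli2.
move=> A mA _; apply/esym; apply: product_measure_unique => // B C mB mC.
transitivity (P (C `&` X k @^-1` B)); first by rewrite setIC.
by rewrite coordinate_indep_others.
Qed.

End IndependentCoordinate.

Section ResamplingOneCoordinate.
Context {R : realType} {disp : measure_display} {T : measurableType disp}.
Context {I : choiceType} (P : probability T R) (X : I -> {RV P >-> R}) (k : I).
Variable f : R -> R.
Hypotheses (indX : mutually_independent X) (fX : has_density (X k) f).
Local Open Scope ereal_scope.

(** In [h x t] the variable [X k] enters only through [x], which is what
    measurability on the product with [other_coordinates] expresses. Freezing
    the others leaves a one-dimensional integral against the law of [X k]. *)
Lemma expectation_shift_coordinate (h : R -> T -> nat) (b r : nat) (s : R) :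
  (forall n, measurable [set p : R * other_coordinates P X k | (n <= h p.1 p.2)%N]) ->
  (forall x t, (h x t <= b)%N) ->
  (forall x y t, (h x t <= h y t + r)%N) ->
  \int[P]_t (h (X k t + s)%R t)%:R%:E
  <= \int[P]_t (h (X k t) t)%:R%:E + r%:R%:E * (`|s|%:E * BV_norm f).
Proof.
move=> mh hb osc.
pose F (u : R) (p : R * other_coordinates P X k) : \bar R := (h (p.1 + u)%R p.2)%:R%:E.
have mF u : measurable_fun setT (F u).
  apply/measurable_EFinP/(@measurable_natr _ _ _ _ b) => // n.
  have mu : measurable_fun setT (fun p : R * other_coordinates P X k => (p.1 + u, p.2)%R).
    apply: measurable_fun_pair => //; apply: measurable_funD => //.
  by have := mu measurableT _ (mh n); rewrite setTI.
have F0 u p : 0 <= F u p by rewrite lee_fin.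
rewrite (ge0_integral_joint P X k indX (F s) (mF s) (F0 s)).
rewrite (_ : \int[P]_t (h (X k t) t)%:R%:E = \int[P]_t F 0%R (X k t, t)); last first.
  by apply: eq_integral => t _; rewrite /F /= addr0.
rewrite (ge0_integral_joint P X k indX (F 0%R) (mF 0%R) (F0 0%R)).
have [mf f0 _] := fX.
set c := r%:R%:E * _.
have c0 : 0 <= c by rewrite mule_ge0// mule_ge0// BV_norm_ge0.
rewrite [X in _ <= _ + X](_ : c = \int[distribution P (forget P X k)]_t c); last first.
  by rewrite integral_cst//= probability_setT mule1.
rewrite -ge0_integralD//; last 2 first.
- by move=> t _; exact: integral_ge0.
- by apply: (measurable_fun_fubini_tonelli_G (F 0%R)).
apply: ge0_le_integral => //.
- by move=> t _; exact: integral_ge0.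
- by apply: (measurable_fun_fubini_tonelli_G (F s)).
- apply: emeasurable_funD => //.
  by apply: (measurable_fun_fubini_tonelli_G (F 0%R)).
move=> t _.
rewrite [X in _ <= X + _](_ : _ = \int[distribution P (X k)]_x (h x t)%:R%:E);
  last first.
  by apply: eq_integral => x _; rewrite /F /= addr0.
apply: (ge0_integral_nat_shift P (X k) f fX s (h^~ t) r) => // n.
have := @measurable_ysection _ _ _ _ _ t (mh n).
by congr measurable; apply/seteqP; split => x; rewrite /ysection /= inE.
Qed.

End ResamplingOneCoordinate.

(** * Shifting all coupling constants *)

Section AveragedShift.
Context {R : realType} {disp : measure_display} {T : measurableType disp}.
Context {I : choiceType} (P : probability T R) (X : I -> {RV P >-> R}).
Context {N : nat} (M : 'M[R[i]]_N) (s : seq I) (a : I -> 'I_N -> R) (f : R -> R).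
Hypotheses (indX : mutually_independent X) (fX : forall k, has_density (X k) f).
Hypothesis herm_M : M \is hermsymmx.

(** The alloy potential on the cube, as a linear function of the couplings [y]:
    the coupling [k] contributes the profile [a k]. *)
Definition linear_potential (y : I -> R) (i : 'I_N) : R := \sum_(k <- s) y k * a k i.

(** The rank of the diagonal matrix with entries [a k i]. *)
Definition site_rank (k : I) : nat := #|[set i | a k i != 0]%SET|.

(** The offset [b] records the shifts already applied to the couplings, so that
    this step can be iterated. *)
Lemma shift_one_coupling (E sigma : R) (b : I -> R) (k : I) :
  (\int[P]_t (low_count M (linear_potential
      (fun j => X j t + (b j + sigma * (j == k)%:R))) E)%:R%:E
   <= \int[P]_t (low_count M (linear_potential (fun j => X j t + b j)) E)%:R%:E
      + (site_rank k)%:R%:E * (`|sigma|%:E * BV_norm f))%E.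
Proof.
pose y (x : R) (t : T) (j : I) := (if j == k then x else X j t) + b j.
pose h x t := low_count M (linear_potential (y x t)) E.
have := @expectation_shift_coordinate _ _ _ _ P X k f indX (fX k) h N (site_rank k) sigma.
have -> : (fun t => (h (X k t + sigma) t)%:R%:E : \bar R) = fun t =>
    (low_count M (linear_potential
      (fun j => X j t + (b j + sigma * (j == k)%:R))) E)%:R%:E.
  apply/funext => t; congr (low_count _ (linear_potential _) _)%:R%:E.
  apply/funext => j; rewrite /y; have [->|_] := eqVneq j k.
    by rewrite mulr1 [b k + _]addrC addrA.
  by rewrite mulr0 addr0.
have -> : (fun t => (h (X k t) t)%:R%:E : \bar R) = fun t =>
    (low_count M (linear_potential (fun j => X j t + b j)) E)%:R%:E.
  apply/funext => t; congr (low_count _ (linear_potential _) _)%:R%:E.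
  by apply/funext => j; rewrite /y; have [->|_] := eqVneq j k.
apply=> [n|x t|x x' t].
- apply: measurable_low_count_ge => // i.
  apply: measurable_sum => j; apply: measurable_funM => //.
  apply: measurable_funD => //; have [_|jk] := eqVneq j k; first exact: measurable_fst.
  exact: (measurableT_comp (measurable_other P X k j jk) measurable_snd).
- by rewrite /h; exact: low_count_leN.
- rewrite /h /site_rank; apply: low_count_stable => // i; rewrite inE negbK => /eqP aki.
  rewrite lerD2r /linear_potential le_eqVlt; apply/orP; left; apply/eqP.
  apply: eq_bigr => j _; rewrite /y; have [->|//] := eqVneq j k.
  by rewrite aki !mulr0.
Qed.

(** Telescoping over [l]: each entry of the list shifts its coupling once more
    by [sigma], and the offset [b] absorbs the shifts already made. *)
Lemma shift_couplings (E sigma : R) (b : I -> R) (l : seq I) :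
  (\int[P]_t (low_count M (linear_potential
      (fun j => X j t + (b j + sigma * (count_mem j l)%:R))) E)%:R%:E
   <= \int[P]_t (low_count M (linear_potential (fun j => X j t + b j)) E)%:R%:E
      + (\sum_(k <- l) site_rank k)%:R%:E * (`|sigma|%:E * BV_norm f))%E.
Proof.
elim: l b => [|k l IH] b.
  rewrite big_nil mul0e adde0 le_eqVlt; apply/orP; left; apply/eqP.
  apply: eq_integral => t _; congr (low_count _ (linear_potential _) _)%:R%:E.
  by apply/funext => j; rewrite mulr0 addr0.
have := IH (fun j => b j + sigma * (j == k)%:R).
under eq_integral => t _.
  have -> : (fun j => X j t + (b j + sigma * (j == k)%:R + sigma * (count_mem j l)%:R)) =
      (fun j => X j t + (b j + sigma * (count_mem j (k :: l))%:R)).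
    by apply/funext => j; rewrite /= natrD mulrDr [k == j]eq_sym !addrA.
  over.
move=> /le_trans; apply; apply: le_trans.
  apply: leeD2r; exact: shift_one_coupling.
rewrite big_cons natrD EFinD ge0_muleDl ?lee_fin//.
by rewrite addeA.
Qed.

(** Shifting every coupling by [- delta / ubar] lowers the potential by the
    constant [delta], which is an energy shift. *)
Lemma integrated_count_increment (ubar E delta : R) : uniq s -> ubar != 0 ->
  (forall i, \sum_(k <- s) a k i = ubar) ->
  (\int[P]_t (low_count M (linear_potential (X^~ t)) (E + delta))%:R%:E
   <= \int[P]_t (low_count M (linear_potential (X^~ t)) E)%:R%:E
      + (\sum_(k <- s) site_rank k)%:R%:E * (`|delta / ubar|%:E * BV_norm f))%E.
Proof.
move=> us u0 au; have := shift_couplings E (- (delta / ubar)) (fun=> 0) s.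
rewrite normrN; under eq_integral => t _.
  rewrite (_ : linear_potential _ = fun i => linear_potential (X^~ t) i + - delta); last first.
    apply/funext => i; rewrite /linear_potential.
    rewrite (_ : - delta = \sum_(k <- s) (- (delta / ubar)) * a k i); last first.
      by rewrite -mulr_sumr au mulNr divfK.
    rewrite -big_split/= big_seq [RHS]big_seq; apply: eq_bigr => k ks.
    by rewrite count_uniq_mem// ks mulr1 add0r mulrDl.
  rewrite low_count_shift// opprK.
  over.
move=> /le_trans; apply; apply: leeD2r.
under eq_integral => t _ do under eq_fun do rewrite addr0.
exact: lexx.
Qed.

End AveragedShift.

(** * The restriction of the operator to a cube *)

Section PointMasses.
Context {R : realType} {I : choiceType}.

Lemma esum_single (a : I -> \bar R) (k0 : I) : (0 <= a k0)%E ->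
  (forall k, k != k0 -> a k = 0%E) -> (\esum_(k in [set: I]) a k = a k0)%E.
Proof.
move=> a0 ak; rewrite -[RHS](esum_set1 a0) [RHS]esum_mkcond.
apply: eq_esum => k _; case: ifPn => //; rewrite notin_setE => /eqP /ak//.
Qed.

Lemma rsum_single (a : I -> R) (k0 : I) : (forall k, k != k0 -> a k = 0) ->
  rsum a = a k0.
Proof.
move=> ak; rewrite /rsum !(@esum_single _ k0)//.
- by rewrite -[X in fine X]/(((EFin \o a)^\+ \- (EFin \o a)^\-)%E k0) -funeposneg.
- by move=> k /ak E; rewrite funenegE /= E oppr0 maxxx.
- by move=> k /ak E; rewrite funeposE /= E maxxx.
Qed.

Lemma csum_single (a : I -> R[i]) (k0 : I) : (forall k, k != k0 -> a k = 0) ->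
  csum a = a k0.
Proof.
move=> ak; rewrite /csum !(@rsum_single _ k0); first by case: (a k0).
- by move=> k /ak ->.
- by move=> k /ak ->.
Qed.

Definition point_mass (k0 : I) : I -> R[i] := fun k => (k == k0)%:R.

Lemma inner_point_mass_l k0 (psi : I -> R[i]) :
  ell2_inner (point_mass k0) psi = psi k0.
Proof.
rewrite /ell2_inner (@csum_single _ k0) /point_mass; first by rewrite eqxx conjC_nat mul1r.
by move=> k /negbTE ->; rewrite conjC_nat mul0r.
Qed.

Lemma inner_point_mass_r k0 (phi : I -> R[i]) :
  ell2_inner phi (point_mass k0) = (phi k0)^*%R.
Proof.
rewrite /ell2_inner (@csum_single _ k0) /point_mass; first by rewrite eqxx mulr1.
by move=> k /negbTE ->; rewrite mulr0.
Qed.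

(** Point masses have finite support, so they lie in the domain, and testing
    the symmetry on two of them compares two matrix entries. *)
Lemma symmetric_operator_entry (dom : set (I -> R[i])) H x y :
  symmetric_operator dom H ->
  H (point_mass x) y = (H (point_mass y) x)^*%R.
Proof.
move=> symH; have dom_pm z : dom (point_mass z).
  apply: (dom_finite_support symH); apply: (@sub_finite_set _ _ [set z]) => //.
  by move=> k /=; rewrite /point_mass; have [->//|_] := eqVneq k z; rewrite eqxx.
have := op_symmetric symH (dom_pm y) (dom_pm x).
by rewrite inner_point_mass_l inner_point_mass_r.
Qed.

End PointMasses.

Section CubeHamiltonian.
Context {R : realType} {d : nat}.
Implicit Types (H : (lattice d -> R[i]) -> (lattice d -> R[i])) (L : nat).

Lemma cube_site_inj L : injective (@cube_site d L).
Proof.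
move=> i j /rowP eij; apply: enum_val_inj; apply/ffunP => k.
by have := eij k; rewrite !mxE => -[/val_inj].
Qed.

Lemma cube_sizeE L : cube_size d L = (L.+1 ^ d)%N.
Proof. by rewrite /cube_size card_ffun !card_ord. Qed.

Definition free_cube_matrix H L : 'M[R[i]]_(cube_size d L) :=
  lin1_mx (fun v => cube_restr L (H (cube_incl v))).

Lemma cube_incl_delta L (i : 'I_(cube_size d L)) :
  cube_incl (delta_mx 0 i) = point_mass (cube_site i) :> (lattice d -> R[i]).
Proof.
apply/funext => k; rewrite /cube_incl /point_mass.
have [->|ki] := eqVneq k (cube_site i).
  rewrite (big_pred1 i) => [|j /=]; last by rewrite (inj_eq (@cube_site_inj L)).
  by rewrite mxE !eqxx.
rewrite big1// => j /eqP jk; rewrite mxE eqxx/=; case: eqP => // ji.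
by rewrite -jk ji eqxx in ki.
Qed.

Lemma free_cube_matrix_herm dom H L : symmetric_operator dom H ->
  free_cube_matrix H L \is hermsymmx.
Proof.
move=> symH; apply/is_hermitianmxP; rewrite expr0 scale1r.
apply/matrixP => i j; rewrite !mxE !cube_incl_delta.
exact: (symmetric_operator_entry _ _ _ _ symH).
Qed.

Lemma cube_hamiltonianE H (V : lattice d -> R) L :
  cube_hamiltonian H V L =
  add_potential (free_cube_matrix H L) (fun i => V (cube_site i)).
Proof.
apply/matrixP => i j; rewrite !mxE eqxx/=; congr (_ + _).
by have [->|ij] := eqVneq i j; rewrite ?mulr1 ?mulr0.
Qed.

End CubeHamiltonian.

Section FiniteSupport.
Context {R : realType} {d : nat} (n : nat) (u : lattice d -> R).
Hypothesis supp_u : forall k, u k != 0 -> forall j, - n%:Z <= k 0 j <= 0.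

Lemma finite_support_u : finite_set [set k | u k != 0].
Proof.
pose F (g : {ffun 'I_d -> 'I_n.+1}) : lattice d := \row_j - (g j : nat)%:Z.
apply: (@sub_finite_set _ _ (range F)); last exact: finite_image.
move=> k /= /supp_u kn.
exists [ffun j => inord (absz (k 0 j))] => //; apply/rowP => j; rewrite mxE ffunE.
have := kn j; move: (k 0 j) => z zn; rewrite inordK; lia.
Qed.

Definition support_seq : seq (lattice d) := fset_set [set k | u k != 0].

Lemma mem_support_seq k : (k \in support_seq) = (u k != 0).
Proof. by rewrite in_fset_set ?mem_setE//; exact: finite_support_u. Qed.

Lemma potential_meanE : potential_mean u = \sum_(k <- support_seq) u k.
Proof.
rewrite /potential_mean (fsbigE support_seq)//; first by apply: eq_bigl => k; rewrite in_setT.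
  exact: fset_uniq.
by move=> k _; rewrite mem_support_seq negbK => /eqP.
Qed.

(** The sites whose coupling constant influences the potential on the cube. *)
Definition couplings L : seq (lattice d) :=
  undup [seq cube_site i - z | i <- enum 'I_(cube_size d L), z <- support_seq].

(** Change of variables [z = x - k] for a fixed site [x] of the cube: the
    couplings that act on [x] correspond to the support of [u]. *)
Lemma big_couplings (V : nmodType) L (i : 'I_(cube_size d L)) (F : lattice d -> V) :
  \sum_(k <- couplings L | u (cube_site i - k) != 0) F k =
  \sum_(z <- support_seq) F (cube_site i - z).
Proof.
rewrite -(big_map (fun z => cube_site i - z) xpredT) -[LHS]big_filter; apply: perm_big.
apply: uniq_perm; first by rewrite filter_uniq// undup_uniq.
  by rewrite map_inj_uniq ?fset_uniq// => z z' /addrI /oppr_inj.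
move=> k; rewrite mem_filter mem_undup; apply/andP/mapP => [[uk _]|[z zs ->]].
  by exists (cube_site i - k); rewrite ?mem_support_seq// opprB addrCA subrr addr0.
rewrite opprB addrCA subrr addr0 -mem_support_seq; split => //.
by apply/allpairsP; exists (i, z); rewrite mem_enum.
Qed.

Lemma alloy_potentialE L (w : lattice d -> R) (i : 'I_(cube_size d L)) :
  alloy_potential u w (cube_site i) =
  \sum_(k <- couplings L) w k * u (cube_site i - k).
Proof.
rewrite /alloy_potential (fsbigE (couplings L))//; first last.
- move=> k _ kL; have [->|uk] := eqVneq (u (cube_site i - k)) 0; first by rewrite mulr0.
  case/negP: kL; rewrite mem_undup; apply/allpairsP; exists (i, cube_site i - k).
  by rewrite mem_enum mem_support_seq uk /= opprB addrCA subrr addr0.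
- exact: undup_uniq.
by apply: eq_bigl => k; rewrite in_setT.
Qed.

Lemma sum_couplings_mean L (i : 'I_(cube_size d L)) :
  \sum_(k <- couplings L) u (cube_site i - k) = potential_mean u.
Proof.
rewrite (bigID (fun k => u (cube_site i - k) != 0))/= big_couplings.
rewrite [X in _ + X]big1 ?addr0; last by move=> k; rewrite negbK => /eqP.
rewrite potential_meanE; apply: eq_bigr => z _.
by rewrite opprB addrCA subrr addr0.
Qed.

(** Double counting of the pairs of a cube site and a coupling acting on it.
    Couplings near the boundary act on few sites of the cube, which is why
    the total is proportional to the volume of the cube itself. *)
Lemma sum_site_rank L :
  (\sum_(k <- couplings L) site_rank (fun k i => u (@cube_site d L i - k)) k =
   L.+1 ^ d * potential_rank u)%N.
Proof.
under eq_bigr => k _ do rewrite /site_rank -sum1_card big_mkcond/=.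
rewrite exchange_big/= -cube_sizeE -[X in (X * _)%N]card_ord -sum_nat_const.
apply: eq_bigr => i _.
under eq_bigr => k _ do rewrite inE.
by rewrite -big_mkcond (big_couplings nat L i (fun=> 1%N)) sum1_size.
Qed.

End FiniteSupport.

(** * Expected eigenvalue counts *)

(** The integral of a nonnegative function is a supremum over the simple
    functions below it, so it is monotone on arbitrary nonnegative functions.
    This is applied to the eigenvalue count of a closed interval. *)
Lemma le_ge0_integralT {d : measure_display} {S : measurableType d} {R : realType}
    (mu : {measure set S -> \bar R}) (f g : S -> \bar R) :
  (forall x, 0 <= f x)%E -> (forall x, f x <= g x)%E ->
  (\int[mu]_x f x <= \int[mu]_x g x)%E.
Proof.
move=> f0 fg; rewrite !ge0_integralTE// => [|x]; last exact: le_trans (f0 x) (fg x).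
apply: ereal_sup_le => _ [h hf <-].
by exists h => // x; exact: le_trans (hf x) (fg x).
Qed.

(** Both conclusions follow from an increment bound on the integrated count that
    is uniform in the energy. *)
Section IntegratedCount.
Context {R : realType} {disp : measure_display} {T : measurableType disp}.
Context (P : probability T R) {N : nat} (M : 'M[R[i]]_N) (V : T -> 'I_N -> R).
Variable C : R.
Hypothesis herm_M : M \is hermsymmx.
Hypothesis mV : forall i, measurable_fun [set: T] (V^~ i).

Let count E t : R := (low_count M (V t) E)%:R.

Hypothesis increment : forall E delta : R,
  (\int[P]_t (count (E + delta) t)%:E
   <= \int[P]_t (count E t)%:E + (C * `|delta|)%:E)%E.

Let mcount E : measurable_fun [set: T] (fun t => (count E t)%:E).
Proof. by apply/measurable_EFinP; exact: measurable_low_count. Qed.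

Lemma integrated_count_fin E : (\int[P]_t (count E t)%:E)%E \is a fin_num.
Proof.
rewrite ge0_fin_numE; last by apply: integral_ge0 => t _; rewrite lee_fin.
apply: (@le_lt_trans _ _ (\int[P]_t N%:R%:E)%E).
  apply: le_ge0_integralT => t; rewrite lee_fin ?ler0n// ler_nat.
  exact: low_count_leN.
by rewrite integral_cst//= probability_setT mule1 ltry.
Qed.

Lemma expected_count_window (E eps : R) : 0 < eps ->
  ('E_P[fun t => (spectral_count `[E - eps, E + eps] (add_potential M (V t)))%R]
   <= (C * (4 * eps))%:E)%E.
Proof.
move=> eps0; rewrite unlock.
pose g t : R := count (E + eps) t - count (E - 3 * eps) t.
have le_g t : spectral_count `[E - eps, E + eps] (add_potential M (V t)) <= g t.
  by rewrite lerBrDr; exact: spectral_count_itv.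
have g_ge0 t : 0 <= g t by exact: le_trans (spectral_count_ge0 _ _) (le_g t).
apply: (@le_trans _ _ (\int[P]_t (g t)%:E)%E).
  by apply: le_ge0_integralT => t; rewrite lee_fin ?spectral_count_ge0.
have mg : measurable_fun [set: T] (fun t => (g t)%:E).
  by apply/measurable_EFinP/measurable_funB; exact: measurable_low_count.
have := increment (E - 3 * eps) (4 * eps).
rewrite (_ : E - 3 * eps + 4 * eps = E + eps); last by lra.
rewrite (@gtr0_norm _ (4 * eps)) ?mulr_gt0//.
have -> : (\int[P]_t (count (E + eps) t)%:E =
    \int[P]_t (count (E - 3 * eps) t)%:E + \int[P]_t (g t)%:E)%E.
  rewrite -ge0_integralD//=; first by apply: eq_integral => t _; rewrite -EFinD /g subrKC.
  - by move=> t _; rewrite lee_fin.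
  - by move=> t _; rewrite lee_fin.
by rewrite leeD2lE// integrated_count_fin.
Qed.

Lemma expected_count_lipschitz : exists F : R -> R,
  (forall E : R,
     'E_P[fun t => (spectral_count `]-oo, E] (add_potential M (V t)))%R] = (F E)%:E)%E
  /\ [lipschitz F E | E in [set: R]].
Proof.
exists (fun E => fine (\int[P]_t (count E t)%:E)%E); split.
  move=> E; rewrite fineK ?integrated_count_fin// unlock.
  by apply: eq_integral => t _; rewrite spectral_count_le.
have incr x y : fine (\int[P]_t (count x t)%:E)%E - fine (\int[P]_t (count y t)%:E)%E
    <= C * `|x - y|.
  have := increment y (x - y); rewrite addrC subrK.
  rewrite -(fineK (integrated_count_fin x)) -(fineK (integrated_count_fin y)).
  by rewrite -EFinD lee_fin lerBlDl.
apply: (@klipschitzW _ _ _ C).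
  exact: (@globally_properfilter _ _ (0, 0)).
move=> [x y] _ /=; rewrite ler_norml; apply/andP; split; last exact: incr.
by rewrite lerNl opprB distrC; exact: incr.
Qed.

End IntegratedCount.

Theorem corollary4 (R : realType) (d n : nat)
    (dom : set (lattice d -> R[i]))
    (H0 : (lattice d -> R[i]) -> (lattice d -> R[i]))
    (u : lattice d -> R) (f : R -> R)
    (disp : measure_display) (T : measurableType disp) (P : probability T R)
    (omega : lattice d -> {RV P >-> R}) :
  (0 < n)%N ->
  symmetric_operator dom H0 ->
  (forall k, u k != 0 -> forall j, - n%:Z <= k 0 j <= 0) ->
  potential_mean u != 0 ->
  mutually_independent omega ->
  (forall k, has_density (omega k) f) ->
  BV_line f ->
  let HL (L : nat) (t : T) :=
    cube_hamiltonian H0 (alloy_potential u (fun k => omega k t)) L in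
  forall L : nat,
    (forall E eps : R, 0 < eps ->
       ('E_P[fun t => (spectral_count `[E - eps, E + eps] (HL L t))%R]
        <= (4 / `|potential_mean u| * (potential_rank u)%:R
            * fine (BV_norm f) * eps * (L + n)%:R ^+ d)%R%:E)%E)
    /\ exists N : R -> R,
         (forall E : R,
            ('E_P[fun t => (spectral_count `]-oo, E] (HL L t))%R] = (N E)%:E)%E)
         /\ [lipschitz N E | E in [set: R]].
Proof.
move=> n_gt0 symH supp_u ubar0 indep dens bv HL L.
pose M := free_cube_matrix H0 L.
have hM : M \is hermsymmx by exact: free_cube_matrix_herm symH.
pose s := couplings u L.
pose a (k : lattice d) (i : 'I_(cube_size d L)) := u (cube_site i - k).
pose V t := linear_potential s a (fun k => omega k t).
have HLE t : HL L t = add_potential M (V t).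
  rewrite /HL cube_hamiltonianE; congr add_potential; apply/funext => i.
  exact: alloy_potentialE supp_u _ _ _.
have mV i : measurable_fun [set: T] (V^~ i).
  by apply: measurable_sum => k; apply: measurable_funM.
pose C := (L.+1 ^ d * potential_rank u)%:R * (fine (BV_norm f) / `|potential_mean u|).
have BVfin : BV_norm f = (fine (BV_norm f))%:E.
  by rewrite fineK// ge0_fin_numE// BV_norm_ge0.
have incr (E delta : R) : (\int[P]_t (low_count M (V t) (E + delta))%:R%:E
    <= \int[P]_t (low_count M (V t) E)%:R%:E + (C * `|delta|)%:E)%E.
  have := @integrated_count_increment _ _ _ _ _ omega _ M s a f indep dens hM
    (potential_mean u) E delta (undup_uniq _) ubar0 (sum_couplings_mean _ _ supp_u L).
  rewrite (sum_site_rank _ _ supp_u) BVfin -!EFinM.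
  congr (_ <= _ + _%:E)%E; rewrite /C normrM normfV.
  by rewrite -!mulrA; congr (_ * _); rewrite mulrCA mulrA [LHS]mulrC.
split=> [E eps eps0|].
  have -> : (fun t => spectral_count `[E - eps, E + eps] (HL L t)) =
      fun t => spectral_count `[E - eps, E + eps] (add_potential M (V t)).
    by apply/funext => t; rewrite HLE.
  apply: (le_trans (expected_count_window P M V C hM mV incr E eps eps0)).
  rewrite lee_fin /C.
  set B := fine (BV_norm f); set q := `|potential_mean u|^-1.
  have B0 : 0 <= B by rewrite fine_ge0// BV_norm_ge0.
  have q0 : 0 <= q by rewrite invr_ge0.
  rewrite (_ : _ * (4 * eps) = 4 * q * (potential_rank u)%:R * B * eps * (L.+1 ^ d)%:R).
    rewrite ler_wpM2l//; first by rewrite !mulr_ge0// ltW.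
    by rewrite natrX lerXn2r ?nnegrE// ler_nat -addn1 leq_add2l.
  rewrite natrM; ring.
have [F [FE Flip]] := expected_count_lipschitz P M V C hM incr.
by exists F; split => // E; rewrite -FE; congr expectation; apply/funext => t; rewrite HLE.
Qed.
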